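(* Let $\mathbb{K}$ be a field and let $(U,Q_U)$ be a finite-dimensional quadratic space over $\mathbb{K}$. Then: (1) There is a virtual quadratic space $(V,Q_V,U)$ with $Q_V|_U=Q_U$. (2) For such an embedding, the group $\mathrm{Iso}(V,U)$ depends (up to isomorphism) only on $Q_U$: if $(V,Q_V,U)$ and $(V',Q_{V'},U)$ are virtual quadratic spaces with $Q_V|_U=Q_U=Q_{V'}|_U$, then $\mathrm{Iso}(V,U)\cong\mathrm{Iso}(V',U)$. (3) Such a $V$ can always be chosen so that $\dim V=\dim U+\dim(U\cap U^\perp)$. Moreover, given any virtual quadratic space $(V',Q_{V'},U)$ with $Q_{V'}|_U=Q_U$, such a $V$ can be chosen as a subspace $U\subseteq V\subseteq V'$ with $Q_V=Q_{V'}|_V$. For a virtual quadratic space $(V,Q_V,U)$ with $Q_V|_U=Q_U$, the condition $\dim V=\dim U+\dim(U\cap U^\perp)$ is equivalent to the condition that $U^\perp\subseteq U$, where $U^\perp$ is taken in $V$. (4) If $\mathrm{Rad}\,Q_U=\{0\}$, then for every virtual quadratic space $(V,Q_V,U)$ with $Q_V|_U=Q_U$ the restriction map $\mathrm{Iso}(V,U)\to\mathrm{Iso}(U)$, $\varphi\mapsto\varphi|_U$, is surjective.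
   Context: All vector spaces are finite-dimensional over a field $\mathbb{K}$ of arbitrary characteristic. A quadratic space is a pair $(V,Q)$ of a vector space and a quadratic form on it; its associated bilinear form is $B(x,y)=Q(x+y)-Q(x)-Q(y)$, and $\perp$ refers to $B$. The radical is $\mathrm{Rad}\,Q=\{v : Q(v+u)=Q(u)\text{ for all }u\}$. $Q$ is non-degenerate if $B$ is non-degenerate (no non-zero $v$ satisfies $B(v,u)=0$ for all $u$). $\mathrm{Iso}(U)$ is the group of bijective linear maps $\varphi\colon U\to U$ with $Q_U(\varphi(u))=Q_U(u)$ for all $u\in U$. A virtual quadratic space is a triple $(V,Q,U)$ (also written $(V,U)$), where $Q$ is a non-degenerate quadratic form on the vector space $V$ and $U$ is a subspace of $V$. $U^\perp=\{v\in V: B(v,u)=0\text{ for all }u\in U\}$ is taken in $V$. $\mathrm{Iso}(V,U)$ is the group of isometries of $(V,Q)$ that fix $U^\perp$ pointwise. *)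

(* Defs.v *)
From HB Require Import structures.
From mathcomp Require Import ssreflect ssrfun ssrbool eqtype choice ssrnat seq.
From mathcomp Require Import fintype tuple bigop monoid ssralg vector.
From mathcomp Require Import sesquilinear boolp.

Set Implicit Arguments.
Unset Strict Implicit.
Unset Printing Implicit Defensive.

Import GRing.Theory.
Local Open Scope ring_scope.

Section QuadraticForms.
Variables (K : fieldType) (V : vectType K).

Definition polar (q : V -> K) (x y : V) : K := q (x + y) - q x - q y.

Record quadform := QuadForm {
  quad_fun :> V -> K;
  quadZ : forall a x, quad_fun (a *: x) = a ^+ 2 * quad_fun x;
  polar_bilinear : bilinear_for *%R *%R (polar quad_fun)
}.

Implicit Types (Q : quadform) (U : {vspace V}).

Fact polar_bilinear_idfun Q : bilinear_for *%R (idfun \; *%R) (polar Q).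
Proof. exact: polar_bilinear. Qed.

HB.instance Definition _ Q :=
  bilinear_isBilinear.Build K V V K _ _ (polar Q) (polar_bilinear_idfun Q).

Fact polar_hermitian Q x y : polar Q x y = (-1) ^+ false * idfun (polar Q y x).
Proof. by rewrite expr0 mul1r /= /polar [x + y]addrC addrAC. Qed.

HB.instance Definition _ Q :=
  isHermitianSesquilinear.Build K V false idfun (polar Q) (polar_hermitian Q).

(* Orthogonality and non-degeneracy refer to the polar form, without the
   factor 1/2: in characteristic 2 it is alternating and [Q] cannot be
   recovered from it. *)
Definition perp Q U : {vspace V} := orthov (polar Q : {symmetric V}) U.
Definition nondeg Q : bool := nondegenerate (polar Q : {symmetric V}).

Definition in_radical Q (v : V) : Prop := forall u, Q (v + u) = Q u.

Lemma perpP Q U v : reflect {in U, forall u, polar Q v u = 0} (v \in perp Q U).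
Proof. exact: mem_orthovP. Qed.

Lemma nondegP Q :
  reflect (forall v, (forall u, polar Q v u = 0) -> v = 0) (nondeg Q).
Proof.
apply: (iffP eqP) => [rad0 v v_rad|nondegQ].
  by apply/eqP; rewrite -memv0 -rad0; apply/mem_orthovP => u _; apply: v_rad.
apply/vspaceP => v; rewrite memv0; apply/idP/eqP => [/mem_orthovP v_rad|->].
  by apply: nondegQ => u; apply: v_rad; rewrite memvf.
exact: mem0v.
Qed.

End QuadraticForms.

Section Restriction.
Variables (K : fieldType) (V : vectType K) (Q : quadform V) (W : {vspace V}).

Definition restr_fun (w : subvs_of W) : K := Q (vsval w).

Fact restr_quadZ a x : restr_fun (a *: x) = a ^+ 2 * restr_fun x.
Proof. exact: quadZ. Qed.

Fact restr_polar_bilinear : bilinear_for *%R *%R (polar restr_fun).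
Proof.
case: (polar_bilinear Q) => linl linr.
by split=> [u' a x y|u a x y]; [apply: linl | apply: linr].
Qed.

Definition quad_restr : quadform (subvs_of W) :=
  QuadForm restr_quadZ restr_polar_bilinear.

End Restriction.

Section Isometries.
Variables (K : fieldType) (V : vectType K) (Q : quadform V).

Definition is_isometry (f : 'End(V)) : Prop :=
  bijective f /\ forall v, Q (f v) = Q v.

Record isometry := Isometry {
  isom_fun :> 'End(V);
  isom_proof : `[< is_isometry isom_fun >]
}.

HB.instance Definition _ := [isSub for isom_fun].
HB.instance Definition _ := [Choice of isometry by <:].

Implicit Types f g h : isometry.

Lemma isom_bij f : bijective f.
Proof. by have /asboolP[] := isom_proof f. Qed.

Lemma isom_quad f v : Q (f v) = Q v.
Proof. by have /asboolP[] := isom_proof f. Qed.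

Fact isom_lker f : lker f == 0%VS.
Proof. exact/lker0P/bij_inj/isom_bij. Qed.

Fact isom_one_proof : `[< is_isometry \1%VF >].
Proof.
apply/asboolP; split=> [|v]; last by rewrite lfunE.
by exists id => v; rewrite lfunE.
Qed.

Fact isom_mul_proof f g : `[< is_isometry (f \o g)%VF >].
Proof.
apply/asboolP; split=> [|v]; last by rewrite comp_lfunE !isom_quad.
apply: (eq_bij (bij_comp (isom_bij f) (isom_bij g))) => v.
by rewrite comp_lfunE.
Qed.

Fact isom_inv_proof f : `[< is_isometry (f^-1)%VF >].
Proof.
have [fK fVK] := (lker0_lfunK (isom_lker f), lker0_lfunVK (isom_lker f)).
apply/asboolP; split=> [|v]; first by exists f.
by rewrite -[in RHS](fVK v) isom_quad.
Qed.

Definition isom_one := Isometry isom_one_proof.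
Definition isom_mul f g := Isometry (isom_mul_proof f g).
Definition isom_inv f := Isometry (isom_inv_proof f).

Fact isom_mulA : associative isom_mul.
Proof. by move=> f g h; apply/val_inj/comp_lfunA. Qed.

Fact isom_mul1 : left_id isom_one isom_mul.
Proof. by move=> f; apply/val_inj/comp_lfun1l. Qed.

Fact isom_mulr1 : right_id isom_one isom_mul.
Proof. by move=> f; apply/val_inj/comp_lfun1r. Qed.

Fact isom_mulV : left_inverse isom_one isom_inv isom_mul.
Proof. by move=> f; apply/val_inj/lker0_compVf/isom_lker. Qed.

Fact isom_mulrV : right_inverse isom_one isom_inv isom_mul.
Proof. by move=> f; apply/val_inj/lker0_compfV/isom_lker. Qed.

HB.instance Definition _ := isGroup.Build isometry
  isom_mulA isom_mul1 isom_mulr1 isom_mulV isom_mulrV.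

End Isometries.

Section VirtualIsometries.
Variables (K : fieldType) (V : vectType K) (Q : quadform V) (U : {vspace V}).

Definition fixes_perp : pred (isometry Q) :=
  fun f => (perp Q U <= fixedSpace f)%VS.

Record virtual_isometry := VirtualIsometry {
  visom_val :> isometry Q;
  visom_fix : fixes_perp visom_val
}.

HB.instance Definition _ := [isSub for visom_val].
HB.instance Definition _ := [Choice of virtual_isometry by <:].

Fact fixes_perp_group_closed : group_closed fixes_perp.
Proof.
split=> [|f g /fixedSpacesP fixf /fixedSpacesP fixg]; apply/fixedSpacesP => v Uv.
  by rewrite lfunE.
rewrite /= comp_lfunE -{1}(fixg v Uv) lker0_lfunK ?isom_lker //.
exact: fixf.
Qed.

HB.instance Definition _ :=
  SubChoice_isSubGroup.Build (isometry Q) fixes_perp virtual_isometry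
    fixes_perp_group_closed.

End VirtualIsometries.

(* [(V, Q, iota U)] is a virtual quadratic space extending [(U, QU)]: the
   quadratic space [U] is identified with the subspace [limg iota] of [V]. *)
Record virtual_ext (K : fieldType) (U V : vectType K)
    (QU : quadform U) (Q : quadform V) (iota : 'Hom(U, V)) : Prop := VirtualExt {
  vext_nondeg : nondeg Q;
  vext_inj : injective iota;
  vext_form : forall u, Q (iota u) = QU u
}.

(* Main.v *)
(* An isometry [f] of [(V, U)] is determined by its displacement [f - 1], which
   kills [perp U] and takes values in [perp (perp U) = U]; it therefore factors
   through [V / perp U], the dual of [U], and becomes a linear map [A] from the
   dual of [U] to [U].  Being an isometry means [QU (A l) + l (A l) = 0] for
   all functionals [l], which does not mention [V]: hence (2).  No isometry
   between [V] and [V'] over [U] is involved; in characteristic 2 there need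
   not be one.
   For (1), the form [QU u + l u] on the direct sum of [U] and its dual is
   non-degenerate.
   For (4), an isometry of [U] fixes the polar radical of [U] when the radical
   is trivial, so that it extends by the identity of [perp U] to
   [U + perp U], and then to [V] by Witt's theorem, which is proved by
   extending one vector at a time with an explicit reflection, Eichler
   transformation or hyperbolic scaling. *)
Require Import Defs.
From HB Require Import structures.
From mathcomp Require Import ssreflect ssrfun ssrbool eqtype choice ssrnat seq.
From mathcomp Require Import fintype tuple bigop monoid ssralg vector.
From mathcomp Require Import boolp ring zify.
From mathcomp Require sesquilinear.

Set Implicit Arguments.
Unset Strict Implicit.
Unset Printing Implicit Defensive.

Import GRing.Theory.
Local Open Scope ring_scope.

(** * The polar form, duality and orthogonal complements *)

Lemma polarC (K : fieldType) (V : vectType K) (q : V -> K) x y :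
  polar q x y = polar q y x.
Proof. by rewrite /polar [y + x]addrC addrAC. Qed.

Section PolarForm.
Variables (K : fieldType) (V : vectType K) (Q : quadform V).
Implicit Types (x y z : V) (a : K) (U W : {vspace V}).

Lemma polarDr z x y : polar Q z (x + y) = polar Q z x + polar Q z y.
Proof.
by have [_ /(_ z 1 x y)] := polar_bilinear Q; rewrite /= scale1r mul1r.
Qed.

Lemma polar0r z : polar Q z 0 = 0.
Proof. by apply: (addrI (polar Q z 0)); rewrite -polarDr !addr0. Qed.

Lemma polarZr a z x : polar Q z (a *: x) = a * polar Q z x.
Proof.
by have [_ /(_ z a x 0)] := polar_bilinear Q; rewrite polar0r !addr0.
Qed.

Lemma polarNr z x : polar Q z (- x) = - polar Q z x.
Proof. by rewrite -scaleN1r polarZr mulN1r. Qed.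

Lemma polarDl z x y : polar Q (x + y) z = polar Q x z + polar Q y z.
Proof. by rewrite !(polarC _ _ z) polarDr. Qed.

Lemma polarZl a z x : polar Q (a *: x) z = a * polar Q x z.
Proof. by rewrite !(polarC _ _ z) polarZr. Qed.

Lemma polarNl z x : polar Q (- x) z = - polar Q x z.
Proof. by rewrite !(polarC _ _ z) polarNr. Qed.

Lemma polar0l z : polar Q 0 z = 0.
Proof. by rewrite polarC polar0r. Qed.

Definition polarE :=
  (polarDl, polarDr, polarZl, polarZr, polarNl, polarNr, polar0l, polar0r).

Lemma quadD x y : Q (x + y) = Q x + Q y + polar Q x y.
Proof. by rewrite /polar; ring. Qed.

Lemma quadN x : Q (- x) = Q x.
Proof. by rewrite -scaleN1r quadZ sqrrN expr1n mul1r. Qed.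

Lemma polarxx x : polar Q x x = 2 * Q x.
Proof. by rewrite /polar -[x + x]mulr2n -scaler_nat quadZ; ring. Qed.

Lemma perp_mem U x y : x \in perp Q U -> y \in U -> polar Q x y = 0.
Proof. by move=> /perpP; apply. Qed.

Lemma perp_imgP (uT : vectType K) (i : 'Hom(uT, V)) x :
  reflect (forall u, polar Q x (i u) = 0) (x \in perp Q (limg i)).
Proof.
apply: (iffP (perpP _ _ _)) => [x_perp u|x_perp _ /memv_imgP[u _ ->]] //.
by rewrite x_perp ?memv_img ?memvf.
Qed.

(** The codomain is [K^o], the field as a vector space over itself, so that functionals on [uT] form
    the vector space ['Hom(uT, K^o)]. *)
Definition polar_with (uT : vectType K) (i : 'Hom(uT, V)) x (u : uT) : K^o :=
  polar Q x (i u).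

Fact polar_with_linear (uT : vectType K) (i : 'Hom(uT, V)) x :
  linear (polar_with i x).
Proof. by move=> a u v; rewrite /polar_with linearP polarDr polarZr. Qed.

HB.instance Definition _ (uT : vectType K) (i : 'Hom(uT, V)) x :=
  GRing.isLinear.Build K uT K^o _ (polar_with i x) (polar_with_linear i x).

Definition polar_lfun (uT : vectType K) (i : 'Hom(uT, V)) x : 'Hom(uT, K^o) :=
  linfun (polar_with i x).

Fact polar_lfun_is_linear (uT : vectType K) (i : 'Hom(uT, V)) :
  linear (polar_lfun i).
Proof.
move=> a x y; apply/lfunP => u; rewrite add_lfunE scale_lfunE !lfunE.
by rewrite /= /polar_with polarDl polarZl.
Qed.

HB.instance Definition _ (uT : vectType K) (i : 'Hom(uT, V)) :=
  GRing.isLinear.Build K V 'Hom(uT, K^o) _ (polar_lfun i)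
    (polar_lfun_is_linear i).

Definition to_dual (uT : vectType K) (i : 'Hom(uT, V)) : 'Hom(V, 'Hom(uT, K^o))
  := linfun (polar_lfun i).

Lemma to_dualE (uT : vectType K) (i : 'Hom(uT, V)) x u :
  to_dual i x u = polar Q x (i u).
Proof. by rewrite lfunE /= lfunE. Qed.

Lemma lker_to_dual (uT : vectType K) (i : 'Hom(uT, V)) :
  lker (to_dual i) = perp Q (limg i).
Proof.
apply/vspaceP => x; rewrite memv_ker; apply/eqP/perp_imgP => [x0 u|x_perp].
  by rewrite -to_dualE x0 lfunE.
by apply/lfunP => u; rewrite to_dualE x_perp lfunE.
Qed.

Lemma dim_dual (uT : vectType K) : \dim {: 'Hom(uT, K^o)} = \dim {:uT}.
Proof. by rewrite !dimvf /dim /= muln1. Qed.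

Hypothesis nondegQ : nondeg Q.

Lemma nondeg_inj x y : (forall z, polar Q x z = polar Q y z) -> x = y.
Proof.
move=> eq_xy; apply/eqP; rewrite -subr_eq0; apply/eqP/(nondegP _ nondegQ) => z.
by rewrite polarDl polarNl eq_xy subrr.
Qed.

(** For the identity of [V], non-degeneracy gives injectivity and equal dimensions give
    surjectivity. A functional on [uT] is then extended to [V] through the left inverse of [i] and
    represented there. *)
Lemma limg_to_dual (uT : vectType K) (i : 'Hom(uT, V)) :
  injective i -> limg (to_dual i) = fullv.
Proof.
move=> /lker0P ker_i.
have ker1 : lker (to_dual \1) = 0%VS.
  apply/eqP/lker0P => x y eq_xy; apply: nondeg_inj => z.
  by rewrite -[z](id_lfunE z) -!to_dualE eq_xy.
have lim1 : limg (to_dual \1) = fullv.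
  apply/eqP; rewrite eqEdim subvf /= dim_dual.
  by rewrite limg_dim_eq ?ker1 ?capv0.
apply/vspaceP => phi; rewrite memvf.
have := memvf (phi \o i^-1)%VF; rewrite -lim1 => /memv_imgP[x _ def_phi].
apply/memv_imgP; exists x; rewrite ?memvf //; apply/lfunP => u.
rewrite to_dualE -[in LHS](lker0_lfunK ker_i u) -comp_lfunE def_phi.
by rewrite to_dualE id_lfunE.
Qed.

Lemma dim_perp_limg (uT : vectType K) (i : 'Hom(uT, V)) :
  injective i -> \dim {:V} = (\dim {:uT} + \dim (perp Q (limg i)))%N.
Proof.
move=> inj_i; rewrite -(limg_ker_dim (to_dual i)) limg_to_dual //.
by rewrite lker_to_dual capfv dim_dual addnC.
Qed.

Lemma dim_perp W : \dim {:V} = (\dim W + \dim (perp Q W))%N.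
Proof.
have inj_val : injective (linfun (@vsval _ _ W)).
  by move=> u v; rewrite !lfunE => /subvs_inj.
have <- : limg (linfun (@vsval _ _ W)) = W.
  apply/vspaceP => x; apply/memv_imgP/idP => [[u _ ->]|Wx].
    by rewrite lfunE subvsP.
  by exists (vsproj W x); rewrite ?memvf // lfunE /= vsprojK.
by rewrite {1}(dim_perp_limg inj_val) limg_dim_eq // (eqP (_ : lker _ == 0%VS))
   ?capv0 //; apply/lker0P.
Qed.

Lemma perp_perp W : perp Q (perp Q W) = W.
Proof.
apply/esym/eqP; rewrite eqEdim; apply/andP; split.
  by apply/subvP => x Wx; apply/perpP => y /perpP Wy; rewrite polarC Wy.
have := dim_perp W; have := dim_perp (perp Q W); lia.
Qed.

(** A vector orthogonal to all of [perp Q W] lies in the double orthogonal [W]; so some [y] there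
    pairs non-trivially with [x] and can be rescaled. *)
Lemma separate_perp W x :
  x \notin W -> exists2 y, y \in perp Q W & polar Q y x = 1.
Proof.
move=> xW; apply: contrapT => no_y; case/negP: xW.
rewrite -[W]perp_perp; apply/perpP => y Wy; apply/eqP/negPn/negP => xy.
apply: no_y; exists ((polar Q x y)^-1 *: y); first exact: memvZ.
by rewrite polarZl (polarC Q y) mulVf.
Qed.

(** Such an [f] also preserves the polar form, so vectors with equal images pair equally with every
    [z]. *)
Lemma quad_inj (f : 'End(V)) : (forall x, Q (f x) = Q x) -> injective f.
Proof.
move=> quad_f x y eq_fxy; apply: nondeg_inj => z.
have polar_f t : polar Q (f t) (f z) = polar Q t z.
  by rewrite /polar -linearD !quad_f.
by rewrite -!polar_f eq_fxy.
Qed.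

End PolarForm.

(** * Displacements of isometries that fix an orthogonal complement *)

Section Isometry.
Variables (K : fieldType) (V : vectType K) (Q : quadform V).
Implicit Types (x y : V) (W : {vspace V}).

Lemma isometry_of_inj (f : 'End(V)) :
  injective f -> (forall x, Q (f x) = Q x) ->
  exists g : isometry Q, isom_fun g = f.
Proof.
move=> /lker0P ker_f quad_f.
suff isof : `[< is_isometry Q f >] by exists (Isometry isof).
apply/asboolP; split=> //; exists f^-1%VF; first exact: lker0_lfunK.
exact: lker0_lfunVK.
Qed.

Lemma isom_polar (f : isometry Q) x y : polar Q (f x) (f y) = polar Q x y.
Proof. by rewrite /polar -linearD !isom_quad. Qed.

Lemma virtual_fix W (f : virtual_isometry Q W) x : x \in perp Q W -> f x = x.
Proof. exact/fixedSpacesP/visom_fix. Qed.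

(* The displacement [f x - x] is orthogonal to [perp Q W], hence lies in its
   double orthogonal [W]. *)
Lemma virtual_displacement W (f : virtual_isometry Q W) x :
  nondeg Q -> f x - x \in W.
Proof.
move=> nondegQ; suff: f x - x \in perp Q (perp Q W) by rewrite perp_perp.
apply/perpP => y Wy.
by rewrite !polarE -{1}(virtual_fix f Wy) isom_polar subrr.
Qed.

(** This makes the arbitrary choice in [match_dual], which is canonical only modulo the orthogonal
    complement, harmless. *)
Lemma eq_virtual_displacement W (f : virtual_isometry Q W) x y :
  x - y \in perp Q W -> f x - x = f y - y.
Proof.
move=> /(virtual_fix f); rewrite linearB /= => /eqP.
by rewrite subr_eq => /eqP->; rewrite addrAC [x - y]addrC addrK addrC.
Qed.

End Isometry.

(** * Carrying an isometry from one extension to another *)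

Section Transfer.
Variables (K : fieldType) (U V V' : vectType K).
Variables (QU : quadform U) (Q : quadform V) (Q' : quadform V').
Variables (i : 'Hom(U, V)) (i' : 'Hom(U, V')).
Hypotheses (extV : virtual_ext QU Q i) (extV' : virtual_ext QU Q' i').

Lemma vext_polar u v : polar Q (i u) (i v) = polar QU u v.
Proof. by rewrite /polar -linearD !(vext_form extV). Qed.

Lemma vext_lker : lker i == 0%VS.
Proof. exact/lker0P/(vext_inj extV). Qed.

Lemma vext_dim_limg : \dim (limg i) = \dim {:U}.
Proof. by rewrite limg_dim_eq // (eqP vext_lker) capv0. Qed.

(* A linear map matching the functionals that [V] and [V'] induce on [U];
   it is canonical modulo [perp Q (limg i)]. *)
Definition match_dual : 'Hom(V', V) := ((to_dual Q i)^-1 \o to_dual Q' i')%VF.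

Lemma match_dualP x u : polar Q (match_dual x) (i u) = polar Q' x (i' u).
Proof.
rewrite -[LHS]to_dualE comp_lfunE limg_lfunVK ?to_dualE //.
by rewrite (limg_to_dual (vext_nondeg extV) (vext_inj extV)) memvf.
Qed.

(** The displacement of [f] at a vector inducing the same functional on [U] as the argument, carried
    through [U] into [V']. *)
Definition transfer_fun (f : 'End(V)) : 'End(V') :=
  (\1 + (i' \o i^-1 \o (f - \1) \o match_dual))%VF.

Lemma transfer_funE f x :
  transfer_fun f x = x + i' (i^-1%VF (f (match_dual x) - match_dual x)).
Proof. by rewrite add_lfunE !comp_lfunE add_lfunE opp_lfunE !id_lfunE. Qed.

(** Adding [i' d] to [x] changes [Q'] by [QU d] plus the value at [d] of the functional of [x]. The
    step from [y] to [f y = y + i d] changes [Q] by the same amount, which is zero. *)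
Lemma transfer_quad (f : virtual_isometry Q (limg i)) x :
  Q' (transfer_fun f x) = Q' x.
Proof.
rewrite transfer_funE; set y := match_dual x; set d := (i^-1)%VF _.
have def_d : i d = f y - y.
  by rewrite limg_lfunVK //; apply/virtual_displacement/(vext_nondeg extV).
rewrite quadD -match_dualP (vext_form extV') -(vext_form extV) -addrA.
apply/eqP; rewrite -subr_eq0 [Q' x + _]addrC addrK; apply/eqP.
apply: (addrI (Q y)); rewrite addr0 addrA -quadD def_d.
by rewrite [y + _]addrC subrK isom_quad.
Qed.

Lemma transfer_fix (f : virtual_isometry Q (limg i)) x :
  x \in perp Q' (limg i') -> transfer_fun f x = x.
Proof.
move=> /perp_imgP x_perp; rewrite transfer_funE virtual_fix.
  by rewrite subrr !linear0 addr0.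
by apply/perp_imgP => u; rewrite match_dualP.
Qed.

Lemma transfer_ex (f : virtual_isometry Q (limg i)) :
  exists g : virtual_isometry Q' (limg i'),
    forall x, g x = transfer_fun f x.
Proof.
have [g def_g] := isometry_of_inj
  (quad_inj (vext_nondeg extV') (transfer_quad f)) (transfer_quad f).
have fix_g : fixes_perp (limg i') g.
  by apply/fixedSpacesP => x x_perp; rewrite def_g transfer_fix.
by exists (VirtualIsometry fix_g) => x /=; rewrite def_g.
Qed.

End Transfer.
Arguments match_dualP {K U V V' QU Q Q' i i'}.

(** * The transfer is a group isomorphism *)

Section TransferGroup.
Variables (K : fieldType) (U V V' : vectType K).
Variables (QU : quadform U) (Q : quadform V) (Q' : quadform V').
Variables (i : 'Hom(U, V)) (i' : 'Hom(U, V')).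
Hypotheses (extV : virtual_ext QU Q i) (extV' : virtual_ext QU Q' i').

Lemma virtual_isometryP W (f g : virtual_isometry Q W) : f =1 g -> f = g.
Proof. by move=> /lfunP/val_inj/val_inj. Qed.

(** The matching intertwines the transferred map with [f] only modulo [perp Q (limg i)], which is
    enough because displacements factor through that quotient. *)
Lemma match_dual_transfer (f : virtual_isometry Q (limg i)) x :
  match_dual Q Q' i i' (transfer_fun Q Q' i i' f x)
    - f (match_dual Q Q' i i' x) \in perp Q (limg i).
Proof.
apply/perp_imgP => u; rewrite polarDl polarNl (match_dualP extV) transfer_funE.
rewrite polarDl -(match_dualP extV) (vext_polar extV') -(vext_polar extV).
rewrite limg_lfunVK; last exact: virtual_displacement (vext_nondeg extV).
by rewrite !polarE; ring.
Qed.

(** Displacements telescope: [f (g y) - y] is the displacement of [f] at [g y] plus that of [g] at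
    [y]. *)
Lemma transfer_comp (f g : virtual_isometry Q (limg i)) x :
  transfer_fun Q Q' i i' (f \o g)%VF x =
  transfer_fun Q Q' i i' f (transfer_fun Q Q' i i' g x).
Proof.
rewrite [in RHS]transfer_funE.
rewrite (eq_virtual_displacement f (match_dual_transfer g x)) !transfer_funE.
by rewrite comp_lfunE -addrA -!linearD /= [_ - _ + (_ - _)]addrC addrA subrK.
Qed.

Lemma match_dualK x :
  match_dual Q Q' i i' (match_dual Q' Q i' i x) - x \in perp Q (limg i).
Proof.
apply/perp_imgP => u.
by rewrite polarDl polarNl (match_dualP extV) (match_dualP extV') subrr.
Qed.

Lemma transferK (f : virtual_isometry Q (limg i)) x :
  transfer_fun Q' Q i' i (transfer_fun Q Q' i i' f) x = f x.
Proof.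
rewrite !transfer_funE [_ + i' _]addrC addrK.
rewrite lker0_lfunK ?(vext_lker extV') // limg_lfunVK; last first.
  exact: virtual_displacement (vext_nondeg extV).
by rewrite (eq_virtual_displacement f (match_dualK x)) addrC subrK.
Qed.

End TransferGroup.

Lemma virtual_isometry_iso (K : fieldType) (U V V' : vectType K)
    (QU : quadform U) (Q : quadform V) (Q' : quadform V')
    (i : 'Hom(U, V)) (i' : 'Hom(U, V')) :
  virtual_ext QU Q i -> virtual_ext QU Q' i' ->
  exists F : {multiplicative virtual_isometry Q (limg i)
                             -> virtual_isometry Q' (limg i')},
    bijective F.
Proof.
move=> extV extV'.
have [F FE] := choice (transfer_ex extV extV').
have [G GE] := choice (transfer_ex extV' extV).
have FM : {morph F : f g / (f * g)%g}.
  move=> f g; apply: virtual_isometryP => x.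
  by rewrite FE (transfer_comp extV extV') /= comp_lfunE !FE.
pose mF := isMultiplicative.Build _ _ F FM.
exists (HB.pack_for {multiplicative virtual_isometry Q (limg i)
                             -> virtual_isometry Q' (limg i')} F mF).
exists G => f; apply: virtual_isometryP => x.
  have /lfunP eqF : F f =1 transfer_fun Q Q' i i' f by apply: FE.
  by rewrite GE eqF (transferK extV extV').
have /lfunP eqG : G f =1 transfer_fun Q' Q i' i f by apply: GE.
by rewrite FE eqG (transferK extV' extV).
Qed.

(** * Witt's extension theorem in arbitrary characteristic *)

Section WittExtension.
Variables (K : fieldType) (V : vectType K) (Q : quadform V).
Implicit Types (x y u w : V) (W : {vspace V}).

Definition rank1_fun a b x : V := polar Q a x *: b.

Fact rank1_fun_linear a b : linear (rank1_fun a b).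
Proof.
by move=> c x y; rewrite /rank1_fun polarDr polarZr scalerDl scalerA.
Qed.

HB.instance Definition _ a b :=
  GRing.isLinear.Build K V V _ (rank1_fun a b) (rank1_fun_linear a b).

(** Common shape of the three families below: only preservation of [Q] has to be checked, since
    non-degeneracy then gives bijectivity. *)
Lemma isometry_id_plus_rank2 (a b c d : V) : nondeg Q ->
  (forall x, Q (x + polar Q a x *: b + polar Q c x *: d) = Q x) ->
  exists g : isometry Q,
    forall x, g x = x + polar Q a x *: b + polar Q c x *: d.
Proof.
move=> nondegQ quad_g.
pose g : 'End(V) := \1%VF + linfun (rank1_fun a b) + linfun (rank1_fun c d).
have gE x : g x = x + polar Q a x *: b + polar Q c x *: d.
  by rewrite !add_lfunE id_lfunE !lfunE.
have g_quad x : Q (g x) = Q x by rewrite gE.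
have [h def_h] := isometry_of_inj (quad_inj nondegQ g_quad) g_quad.
by exists h => x; rewrite def_h.
Qed.

Lemma reflection_ex w : nondeg Q -> Q w != 0 ->
  exists g : isometry Q, forall x, g x = x - (polar Q w x / Q w) *: w.
Proof.
move=> nondegQ Qw0.
have [x|g gE] := @isometry_id_plus_rank2 w (- (Q w)^-1 *: w) 0 0 nondegQ.
  rewrite scaler0 addr0 quadD !quadZ !polarE (polarC Q x).
  by field.
by exists g => x; rewrite gE scaler0 addr0 scalerA mulrN scaleNr.
Qed.

(** It fixes [w] and sends each [x] orthogonal to [w] to [x + polar Q y x *: w]. *)
Lemma eichler_ex w y : nondeg Q -> Q w = 0 -> polar Q y w = 0 ->
  exists g : isometry Q, forall x,
    g x = x + polar Q y x *: w + polar Q w x *: (- y - Q y *: w).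
Proof.
move=> nondegQ Qw yw; apply: isometry_id_plus_rank2 => // x.
rewrite !(quadD, polarE, quadZ, quadN) (polarC Q x) (polarC Q x y).
rewrite (polarC Q w y) (polarxx Q w) Qw yw.
by ring.
Qed.

(** On the hyperbolic pair it multiplies [w] by [a] and [y] by the inverse of [a]; it fixes all
    vectors orthogonal to both. *)
Lemma hyperbolic_scaling_ex (a : K) w y : nondeg Q -> a != 0 ->
    Q w = 0 -> Q y = 0 -> polar Q y w = 1 ->
  exists g : isometry Q, forall x,
    g x = x + polar Q y x *: ((a - 1) *: w) + polar Q w x *: ((a^-1 - 1) *: y).
Proof.
move=> nondegQ a0 Qw Qy yw; apply: isometry_id_plus_rank2 => // x.
rewrite !(quadD, polarE, quadZ, quadN) (polarC Q x) (polarC Q x y).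
rewrite (polarC Q w y) Qw Qy yw.
by field.
Qed.

(** Induction step of Witt's theorem, normalised so that the map is already the identity on [W]. A
    reflection serves if [Q w] is non-zero, an Eichler transformation if [w] is singular and [u]
    lies outside [W + <[w]>], and a hyperbolic scaling otherwise. *)
Lemma witt_step W u w : nondeg Q ->
    w \in perp Q W -> Q (u + w) = Q u -> u \notin W -> u + w \notin W ->
  exists g : isometry Q, {in W, g =1 id} /\ g u = u + w.
Proof.
move=> nondegQ w_perp quad_uw uW uwW.
have wW x : x \in W -> polar Q w x = 0 by apply: perp_mem.
have wu : polar Q w u = - Q w.
  apply/eqP; rewrite -addr_eq0; apply/eqP/(addrI (Q u)).
  by rewrite addr0 -[RHS]quad_uw quadD (polarC Q u); ring.
have [Qw|Qw0] := eqVneq (Q w) 0; last first.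
  have [g gE] := reflection_ex nondegQ Qw0; exists g; split=> [x Wx|].
    by rewrite gE wW // mul0r scale0r subr0.
  by rewrite gE wu mulNr divff // scaleN1r opprK.
rewrite Qw oppr0 in wu.
have [/memv_addP[h Wh [_ /vlineP[c ->] def_u]]|u_gen] :=
    boolP (u \in (W + <[w]>)%VS); last first.
  (* This [y] is orthogonal to [W] and [w] and pairs to 1 with [u], so its Eichler transformation
     adds exactly [w] to [u]. *)
  have [y y_perp yu] := separate_perp nondegQ u_gen.
  have yw : polar Q y w = 0.
    by apply: perp_mem y_perp _; apply: subvP (addvSr _ _) _ (memv_line w).
  have [g gE] := eichler_ex nondegQ Qw yw; exists g; split=> [x Wx|].
    rewrite gE wW // scale0r addr0 (perp_mem y_perp) ?scale0r ?addr0 //.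
    exact: subvP (addvSl _ _) _ Wx.
  by rewrite gE wu yu scale0r addr0 scale1r.
(* Modulo [W], [u] is now [c *: w]: the wanted isometry scales [w] by
   [(c + 1) / c]. *)
have c0 : c != 0.
  by apply: contraNneq uW => c0; rewrite def_u c0 scale0r addr0.
have c1 : c + 1 != 0.
  apply: contraNneq uwW => c1.
  by rewrite def_u -addrA -{2}[w]scale1r -scalerDl c1 scale0r addr0.
have Ww : w \notin W.
  by apply: contra uW => Ww; rewrite def_u memvD // memvZ.
have [y y_perp yw] := separate_perp nondegQ Ww.
(* Subtracting this multiple of the singular [w] makes [y'] singular and keeps its pairing with [w]
   equal to 1. *)
pose y' := y - Q y *: w.
have ww : polar Q w w = 0 by rewrite polarxx Qw mulr0.
have Qy' : Q y' = 0.
  by rewrite quadD quadN quadZ Qw !polarE yw; ring.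
have y'w : polar Q y' w = 1 by rewrite !polarE yw ww; ring.
have a0 : (c + 1) / c != 0 by rewrite mulf_neq0 ?invr_neq0.
have [g gE] := hyperbolic_scaling_ex nondegQ a0 Qw Qy' y'w.
have gW : {in W, g =1 id}.
  move=> x Wx; rewrite gE wW // !polarE (perp_mem y_perp) // wW //.
  by rewrite mulr0 subr0 !scale0r !addr0.
exists g; split=> //; rewrite {1}def_u linearD linearZ /= gW // gE y'w ww.
rewrite scale0r addr0 scale1r -{1}[w]scale1r -scalerDl scalerA def_u -addrA.
congr (_ + _); rewrite -{3}[w]scale1r -scalerDl; congr (_ *: _).
by field.
Qed.

Lemma witt_span (f : 'End(V)) (X : seq V) : nondeg Q ->
    {in <<X>>%VS, forall x, Q (f x) = Q x} ->
    {in <<X>>%VS, forall x, f x = 0 -> x = 0} ->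
  exists g : isometry Q, {in <<X>>%VS, g =1 f}.
Proof.
move=> nondegQ; elim: X => [|u X IHX] quad_f inj_f.
  exists (isom_one Q) => x; rewrite span_nil memv0 => /eqP->.
  by rewrite !linear0.
have sub_tl : (<<X>> <= <<u :: X>>)%VS by rewrite span_cons addvSr.
have X_u : u \in <<u :: X>>%VS by rewrite memv_span ?mem_head.
have [x Xx|x Xx|g0 g0E] := IHX.
- by apply: quad_f; apply: subvP Xx.
- by apply: inj_f; apply: subvP Xx.
have [uX|uX] := boolP (u \in <<X>>%VS).
  by exists g0; rewrite span_cons addvC (addv_idPl _).
have polar_f :
    {in <<u :: X>>%VS &, forall x y, polar Q (f x) (f y) = polar Q x y}.
  by move=> x y Xx Xy; rewrite /polar -linearD !quad_f ?memvD.
(* Undoing [g0] reduces to a map that is the identity on the span of [X] and sends [u] to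
   [u + w]. *)
pose s := isom_inv g0; pose w := s (f u) - u.
have sK x : x \in <<X>>%VS -> s (f x) = x.
  by move=> Xx; rewrite -g0E // lker0_lfunK ?isom_lker.
have g0K x : g0 (s x) = x by rewrite lker0_lfunVK ?isom_lker.
have uw : u + w = s (f u) by rewrite addrC subrK.
have [|||g1 [g1X g1u]] := @witt_step <<X>>%VS u w nondegQ _ _ uX.
- apply/perpP => x Xx; rewrite polarDl polarNl -{1}[x]sK // isom_polar.
  by rewrite polar_f ?subrr // (subvP sub_tl).
- by rewrite uw isom_quad quad_f.
(* If [s (f u)] were in the span of [X], then [f] and [g0] would agree on it, giving
   [f (s (f u)) = f u]; injectivity would put [u] in the span. *)
- rewrite uw; apply: contra uX => Xsfu.
  suff -> : u = s (f u) by [].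
  apply/eqP; rewrite -subr_eq0; apply/eqP/inj_f.
    by rewrite memvB // (subvP sub_tl).
  by rewrite linearB /= -(g0E _ Xsfu) g0K subrr.
exists (isom_mul g0 g1) => x; rewrite span_cons.
move=> /memv_addP[_ /vlineP[a ->] [h Xh ->]].
by rewrite comp_lfunE !linearD !linearZ /= g1u g1X // uw g0K g0E.
Qed.

Lemma witt_extension (f : 'End(V)) W : nondeg Q ->
    {in W, forall x, Q (f x) = Q x} -> {in W, forall x, f x = 0 -> x = 0} ->
  exists g : isometry Q, {in W, g =1 f}.
Proof. by rewrite -(span_basis (vbasisP W)); apply: witt_span. Qed.

End WittExtension.

(** * A non-degenerate extension on the sum of [U] and its dual *)

Section DualExtension.
Variables (K : fieldType) (U : vectType K) (QU : quadform U).
Implicit Types (x y : U * 'Hom(U, K^o)) (u v : U) (l m : 'Hom(U, K^o)).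

(** The result is typed in [K] rather than [K^o], so that scalars act by field multiplication. *)
Definition dual_eval l u : K := l u.

Lemma dual_evalDl u l m : dual_eval (l + m) u = dual_eval l u + dual_eval m u.
Proof. by rewrite /dual_eval add_lfunE. Qed.

Lemma dual_evalZl u a l : dual_eval (a *: l) u = a * dual_eval l u.
Proof. by rewrite /dual_eval scale_lfunE. Qed.

Lemma dual_evalDr l u v : dual_eval l (u + v) = dual_eval l u + dual_eval l v.
Proof. by rewrite /dual_eval linearD. Qed.

Lemma dual_evalZr l a u : dual_eval l (a *: u) = a * dual_eval l u.
Proof. by rewrite /dual_eval linearZ. Qed.

Definition dual_evalE := (dual_evalDl, dual_evalZl, dual_evalDr, dual_evalZr).

Definition dual_ext_fun x : K := QU x.1 + dual_eval x.2 x.1.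

Lemma polar_dual_ext x y :
  polar dual_ext_fun x y =
  polar QU x.1 y.1 + dual_eval x.2 y.1 + dual_eval y.2 x.1.
Proof. by rewrite /polar /dual_ext_fun /= !dual_evalE; ring. Qed.

Fact dual_extZ a x : dual_ext_fun (a *: x) = a ^+ 2 * dual_ext_fun x.
Proof. by rewrite /dual_ext_fun /= quadZ !dual_evalE; ring. Qed.

Fact dual_ext_polar_bilinear :
  sesquilinear.bilinear_for *%R *%R (polar dual_ext_fun).
Proof.
have linr x : GRing.linear_for *%R (polar dual_ext_fun x).
  move=> a y z; rewrite !polar_dual_ext /= !polarE !dual_evalE; ring.
by split=> // y a x z; rewrite /= !(polarC _ _ y); apply: linr.
Qed.

Definition dual_ext : quadform (U * 'Hom(U, K^o))%type :=
  QuadForm dual_extZ dual_ext_polar_bilinear.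

(** Pairing [(u, l)] with [(0, m)] gives [m u], and a coordinate functional equal to 1 at a non-zero
    [u] forces [u = 0]. Pairing with [(v, 0)] then gives [l v]. *)
Lemma dual_ext_nondeg : nondeg dual_ext.
Proof.
apply/nondegP => -[u l] rad_ul.
have u0 : u = 0.
  apply/eqP/contraT => u_neq0.
  pose c := (coord [tuple u] ord0 : U -> K^o).
  have := rad_ul (0, linfun c).
  rewrite polar_dual_ext /= polar0r add0r /dual_eval linear0 add0r lfunE /c.
  have /(coord_free ord0 ord0) : free [tuple u] by rewrite seq1_free.
  by rewrite /= => -> /eqP; rewrite oner_eq0.
congr (_, _) => //; apply/lfunP => v.
have := rad_ul (v, 0); rewrite polar_dual_ext u0 /= polar0l add0r.
by rewrite /dual_eval !zero_lfunE addr0.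
Qed.

Definition dual_inl u : U * 'Hom(U, K^o) := (u, 0).

Fact dual_inl_linear : linear dual_inl.
Proof. by move=> a u v; congr (_, _); rewrite /= scaler0 addr0. Qed.

HB.instance Definition _ :=
  GRing.isLinear.Build K U (U * 'Hom(U, K^o))%type _ dual_inl dual_inl_linear.

Lemma virtual_ext_ex :
  exists (V : vectType K) (Q : quadform V) (i : 'Hom(U, V)),
    virtual_ext QU Q i.
Proof.
exists (U * 'Hom(U, K^o))%type, dual_ext, (linfun dual_inl).
split=> [|u v|u]; first exact: dual_ext_nondeg.
  by rewrite !lfunE => -[].
by rewrite lfunE /= /dual_ext_fun /dual_eval zero_lfunE addr0.
Qed.

End DualExtension.

(** * Extensions of minimal dimension *)

Section MinimalExtension.
Variables (K : fieldType) (U V : vectType K).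
Variables (QU : quadform U) (Q : quadform V) (i : 'Hom(U, V)).
Hypothesis extV : virtual_ext QU Q i.

Let R := (limg i :&: perp Q (limg i))%VS.

(** As the dimension of [V] is that of [U] plus that of the orthogonal complement, the equation says
    that [R] is the whole complement. *)
Lemma vext_dimP :
  \dim {:V} = (\dim {:U} + \dim R)%N <-> (perp Q (limg i) <= limg i)%VS.
Proof.
rewrite (dim_perp_limg (vext_nondeg extV) (vext_inj extV)) -/R.
split=> [/addnI eq_dim|/capv_idPr eqR]; last by rewrite /R eqR.
by apply/capv_idPr/eqP; rewrite eqEdim capvSr eq_dim /=.
Qed.

(* A complement of [perp Q R] in [V] is dual to [R] under the polar form,
   so that adding it to [U] kills the polar radical [R] of [U]. *)
Lemma minimal_subspace_ex : exists W : {vspace V},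
  [/\ (limg i <= W)%VS, \dim W = (\dim {:U} + \dim R)%N
    & {in W, forall x, {in W, forall y, polar Q x y = 0} -> x = 0}].
Proof.
have nondegQ := vext_nondeg extV.
pose D := ((perp Q R)^C)%VS.
have subU : (limg i <= perp Q R)%VS.
  apply/subvP => x Ux; apply/perpP => y; rewrite memv_cap => /andP[_ /perpP Uy].
  by rewrite polarC Uy.
have capD : (perp Q R :&: D = 0)%VS by apply: capv_compl.
exists (limg i + D)%VS; split; first exact: addvSl.
  rewrite dimv_disjoint_sum; last first.
    by apply/eqP; rewrite -subv0 -capD capvS.
  rewrite (vext_dim_limg extV) dimv_compl (dim_perp nondegQ R).
  by rewrite addnK.
move=> _ /memv_addP[u Uu [d Dd ->]] rad_x.
(* [R] lies in the candidate space and is orthogonal to [u], so [d] is orthogonal to [R] and falls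
   in the trivial intersection with [D]. *)
have d0 : d = 0.
  apply/eqP; rewrite -memv0 -capD memv_cap Dd andbT; apply/perpP => r Rr.
  have := subvP (capvSl _ _) _ Rr; have := subvP subU _ Uu.
  move=> /perpP/(_ r Rr) ur Ur.
  have := rad_x r (subvP (addvSl _ _) _ Ur).
  by rewrite polarDl ur add0r.
rewrite d0 addr0 in rad_x *.
have Ru : u \in R.
  rewrite memv_cap Uu; apply/perpP => y Uy; apply: rad_x.
  exact: subvP (addvSl _ _) _ Uy.
apply: (nondegP _ nondegQ) => y.
(* [V] splits as [perp Q R + D]: [u] kills the first summand because it is in [R], and the second by
   the radical hypothesis. *)
have : y \in (perp Q R + D)%VS by rewrite addv_complf memvf.
move=> /memv_addP[p p_perp [e De ->]]; rewrite polarDr polarC.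
rewrite (perp_mem p_perp) // add0r; apply: rad_x.
exact: subvP (addvSr _ _) _ De.
Qed.

Lemma minimal_ext_ex : exists (W : {vspace V}) (j : 'Hom(U, subvs_of W)),
  [/\ (limg i <= W)%VS, forall u, vsval (j u) = i u,
      virtual_ext QU (quad_restr Q W) j
    & \dim {: subvs_of W} =
        (\dim {:U} + \dim (limg j :&: perp (quad_restr Q W) (limg j)))%N].
Proof.
have [W [subW dimW nondegW]] := minimal_subspace_ex.
pose j : 'Hom(U, subvs_of W) := (linfun (vsproj W) \o i)%VF.
have jE u : vsval (j u) = i u.
  by rewrite comp_lfunE lfunE /= vsprojK // (subvP subW) ?memv_img ?memvf.
have restrE (x y : subvs_of W) :
  polar (quad_restr Q W) x y = polar Q (vsval x) (vsval y) by [].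
have extW : virtual_ext QU (quad_restr Q W) j.
  split=> [|u v eq_uv|u]; last by rewrite /= /restr_fun jE (vext_form extV).
    apply/nondegP => x rad_x; apply/subvs_inj/nondegW; first exact: subvsP.
    by move=> y Wy; rewrite -(vsprojK Wy) -restrE rad_x.
  by apply: (vext_inj extV); rewrite -!jE eq_uv.
exists W, j; split=> //.
have val_inj : lker (linfun (@vsval _ _ W)) == 0%VS.
  by apply/lker0P => x y; rewrite !lfunE => /subvs_inj.
rewrite dimvf [LHS]dimW -(limg_dim_eq (f := linfun (@vsval _ _ W))); last first.
  by rewrite (eqP val_inj) capv0.
(* The inclusion of [W] carries the polar radical of [limg j] onto [R], since orthogonality is
   tested only against vectors from [U]. *)
congr (_ + \dim _)%N; apply/vspaceP => x; apply/idP/memv_imgP => [|[y]].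
  rewrite memv_cap => /andP[/memv_imgP[u _ ->] /perp_imgP u_perp].
  exists (j u); last by rewrite lfunE /= jE.
  rewrite memv_cap memv_img ?memvf //; apply/perp_imgP => v.
  by rewrite restrE !jE.
rewrite memv_cap => /andP[/memv_imgP[u _ ->] /perp_imgP u_perp] ->.
rewrite lfunE /= jE memv_cap memv_img ?memvf //; apply/perp_imgP => v.
by rewrite -!jE -restrE.
Qed.

End MinimalExtension.

(** * The restriction map and its surjectivity *)

Section Restriction.
Variables (K : fieldType) (U V : vectType K).
Variables (QU : quadform U) (Q : quadform V) (i : 'Hom(U, V)).
Hypothesis extV : virtual_ext QU Q i.

(** The displacement of [i u] lies in [limg i], so [f] maps [limg i] into itself. *)
Lemma restriction_ex (f : virtual_isometry Q (limg i)) :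
  exists r : isometry QU, forall u, i (r u) = f (i u).
Proof.
pose r := (i^-1 \o f \o i)%VF.
have rE u : i (r u) = f (i u).
  rewrite !comp_lfunE limg_lfunVK //.
  have /(memvD (memv_img i (memvf u))) :=
    virtual_displacement f (i u) (vext_nondeg extV).
  by rewrite addrC subrK.
have [u v /(congr1 i)|u|g def_g] := @isometry_of_inj _ _ QU r.
- by rewrite !rE => /(bij_inj (isom_bij f))/(vext_inj extV).
- by rewrite -!(vext_form extV) rE isom_quad.
by exists g => u; rewrite def_g.
Qed.

(* For [r] in the polar radical, [g r - r] is again in it, and there [Q] takes
   the value [2 Q(r) = B(r, r) = 0]: it lies in the radical of the form. *)
Lemma isom_fix_polar_radical (g : isometry QU) r :
    (forall u, in_radical QU u -> u = 0) ->
  (forall u, polar QU r u = 0) -> g r = r.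
Proof.
move=> rad0 r_perp; apply/eqP; rewrite -subr_eq0; apply/eqP/rad0 => u.
have d_perp v : polar QU (g r - r) v = 0.
  have -> : v = g (isom_inv g v) by rewrite lker0_lfunVK ?isom_lker.
  by rewrite polarDl polarNl isom_polar !r_perp subrr.
rewrite quadD d_perp addr0 quadD quadN isom_quad polarNr polarC r_perp.
rewrite oppr0 addr0 -mulr2n -mulr_natl -polarxx r_perp.
by rewrite add0r.
Qed.

Lemma restriction_onto (g : isometry QU) :
    (forall u, in_radical QU u -> u = 0) ->
  exists f : virtual_isometry Q (limg i), forall u, f (i u) = i (g u).
Proof.
move=> rad0; set P := perp Q (limg i).
have g_fix u : i u \in P -> g u = u.
  move=> /perp_imgP u_perp; apply: isom_fix_polar_radical => // v.
  by rewrite -(vext_polar extV).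
pose p1 := addv_pi1 (limg i) P; pose p2 := addv_pi2 (limg i) P.
(* The sum need not be direct, so [p1] and [p2] are one chosen decomposition; [h_split] shows that
   any other gives the same value, as two differ by an overlap vector, which [g] fixes. *)
pose h : 'End(V) := (i \o g \o i^-1 \o p1 + p2)%VF.
have h_split u p : p \in P -> h (i u + p) = i (g u) + p.
  move=> Pp; have := @addv_pi1_pi2 _ _ (limg i) P (i u + p).
  rewrite memv_add ?memv_img ?memvf // => /(_ isT).
  rewrite add_lfunE !comp_lfunE -/p1 -/p2.
  have /memv_imgP[v _ ->] : p1 (i u + p) \in limg i :=
    memv_pi1 (limg i) P _.
  have : p2 (i u + p) \in P := memv_pi2 (limg i) P _.
  move: (p2 _) => q Pq eq_uv; rewrite lker0_lfunK ?(vext_lker extV) //.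
  have eq_pq : i (u - v) = q - p.
    by apply/eqP; rewrite linearB subr_eq addrAC eq_sym subr_eq addrC eq_uv.
  have Puv : i (u - v) \in P by rewrite eq_pq memvB.
  have -> : q = i (g (u - v)) + p by rewrite g_fix // eq_pq subrK.
  by rewrite addrA -!linearD /= [v + _]addrC subrK.
have h_quad : {in (limg i + P)%VS, forall x, Q (h x) = Q x}.
  move=> _ /memv_addP[_ /memv_imgP[u _ ->] [p Pp ->]]; rewrite h_split //.
  rewrite !quadD !(vext_form extV) isom_quad !(polarC _ _ p).
  by rewrite !(perp_mem Pp) ?memv_img ?memvf.
have h_inj : {in (limg i + P)%VS, forall x, h x = 0 -> x = 0}.
  move=> _ /memv_addP[_ /memv_imgP[u _ ->] [p Pp ->]]; rewrite h_split //.
  move=> /eqP; rewrite addr_eq0 => /eqP gu_p.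
  have Pgu : i (g u) \in P by rewrite gu_p memvN.
  (* [i (g u) = - p] lies in the overlap, so [g] fixes [g u], hence [g u = u] and the sum [i u + p]
     vanishes. *)
  have /(bij_inj (isom_bij g)) <- : g (g u) = g u by apply: g_fix.
  by rewrite gu_p addNr.
have [G GE] := witt_extension (vext_nondeg extV) h_quad h_inj.
have G_fix : fixes_perp (limg i) G.
  apply/fixedSpacesP => p Pp; rewrite GE ?(subvP (addvSr _ _)) //.
  by rewrite -[p]add0r -(linear0 i) h_split // !linear0.
exists (VirtualIsometry G_fix) => u /=.
rewrite GE; last by rewrite (subvP (addvSl _ _)) ?memv_img ?memvf.
by rewrite -[i u]addr0 h_split ?mem0v // addr0.
Qed.

End Restriction.

Theorem theorem3p9 (K : fieldType) (U : vectType K) (QU : quadform U) :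
  [/\ (* (1) *)
      exists (V : vectType K) (Q : quadform V) (i : 'Hom(U, V)),
        virtual_ext QU Q i,
      (* (2) *)
      forall (V V' : vectType K) (Q : quadform V) (Q' : quadform V')
             (i : 'Hom(U, V)) (i' : 'Hom(U, V')),
        virtual_ext QU Q i -> virtual_ext QU Q' i' ->
        exists F : {multiplicative virtual_isometry Q (limg i)
                                   -> virtual_isometry Q' (limg i')},
          bijective F,
      (* (3) *)
      [/\ exists (V : vectType K) (Q : quadform V) (i : 'Hom(U, V)),
            virtual_ext QU Q i /\
            \dim {:V} = (\dim {:U} + \dim (limg i :&: perp Q (limg i)))%N,
          forall (V' : vectType K) (Q' : quadform V') (i' : 'Hom(U, V')),
            virtual_ext QU Q' i' ->
            exists (W : {vspace V'}) (i : 'Hom(U, subvs_of W)),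
              [/\ (limg i' <= W)%VS,
                  forall u, vsval (i u) = i' u,
                  virtual_ext QU (quad_restr Q' W) i
                & \dim {: subvs_of W} =
                    (\dim {:U}
                     + \dim (limg i :&: perp (quad_restr Q' W) (limg i)))%N]
        & forall (V : vectType K) (Q : quadform V) (i : 'Hom(U, V)),
            virtual_ext QU Q i ->
            \dim {:V} = (\dim {:U} + \dim (limg i :&: perp Q (limg i)))%N
            <-> (perp Q (limg i) <= limg i)%VS]
    & (* (4) *)
      (forall u, in_radical QU u <-> u = 0%R) ->
      forall (V : vectType K) (Q : quadform V) (i : 'Hom(U, V)),
        virtual_ext QU Q i ->
        exists res : virtual_isometry Q (limg i) -> isometry QU,
          (forall f u, i (res f u) = f (i u)) /\
          (forall g, exists f, res f = g)].
Proof.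
split.
- exact: virtual_ext_ex.
- by move=> V V' Q Q' i i'; apply: virtual_isometry_iso.
- split.
  + have [V' [Q' [i' extV']]] := virtual_ext_ex QU.
    have [W [i [_ _ extW dimW]]] := minimal_ext_ex extV'.
    by exists (subvs_of W), (quad_restr Q' W), i.
  + by move=> V' Q' i'; apply: minimal_ext_ex.
  + by move=> V Q i; apply: vext_dimP.
move=> rad0 V Q i extV.
have [res resE] := choice (restriction_ex extV).
exists res; split=> [f u|g]; first exact: resE.
have [|f fE] := restriction_onto extV g; first by move=> u /rad0.
exists f; apply/val_inj/lfunP => u.
by apply: (vext_inj extV); rewrite resE fE.
Qed.
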